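(* Let $\bar C_{obs}(s)=K_{aug}(sI_{n+N}-A_{obs})^{-1}L_{aug}$ be the transfer function from $w^m$ to $-u$ of the observer-based compensator $$\dot{\hat x}_{aug}=A_{obs}\hat x_{aug}+L_{aug}w^m,\qquad -u=K_{aug}\hat x_{aug},\qquad A_{obs}=A_{aug}-B_{aug}K_{aug}-L_{aug}C_{aug}.$$ Assume: (i) the eigenvalues of $A_N$ and $A-BK$ are disjoint; $A-BK$ has no eigenvalues that are uncontrollable from $L_1$; and, for each eigenvalue $\lambda_i$ of $A_N$ with associated left eigenvector $w_i^T$, $i=1,\dots,N$, $w_i^TB_NC(\lambda_iI_n-A+BK)^{-1}L_1+w_i^TL_2\neq0$; (ii) the eigenvalues of $A_{aug}-L_{aug}C_{aug}$ and $A-L_1D_NC$ are disjoint, and $K(\lambda I_n-A+L_1D_NC)^{-1}L_1\ne 0$ for every eigenvalue $\lambda$ of $A_{aug}-L_{aug}C_{aug}$. Then the transmission zeros of $\bar C_{obs}(s)$ include zeros at the open left half plane mirror images of the $N$ nonminimum phase zeros of $P_N(s)$; that is, if $z_1,\dots,z_N$ are the zeros of $P_N(s)$, then each $-z_i$ is a transmission zero of $\bar C_{obs}(s)$.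
   Context: Let $n,N\ge 1$ be integers, $\tau>0$, $A\in\mathbb{R}^{n\times n}$, $B,E\in\mathbb{R}^{n\times 1}$, $C\in\mathbb{R}^{1\times n}$, with $(A,C)$ observable and $(A,B)$, $(A,E)$ controllable. $P_N(s)$ denotes the $N$-th order (diagonal) Padé approximation of the delay $e^{-s\tau}$: $P_N(s)=Q_N(-s)/Q_N(s)$ with $Q_N(s)=\sum_{k=0}^N\frac{(2N-k)!\,N!}{(2N)!\,k!\,(N-k)!}(\tau s)^k$ (e.g. $P_1(s)=(2-\tau s)/(2+\tau s)$). It has $N$ zeros $z_1,\dots,z_N$ in the open right half plane (''nonminimum phase zeros'') and $N$ distinct poles $-z_1,\dots,-z_N$, and it is allpass: $P_N(s)P_N(-s)=1$. The quadruple $(A_N,B_N,C_N,D_N)$ is a minimal real realization, $P_N(s)=C_N(sI_N-A_N)^{-1}B_N+D_N$, with $A_N\in\mathbb{R}^{N\times N}$. $K\in\mathbb{R}^{1\times n}$ is a state feedback gain and $L_1\in\mathbb{R}^n$, $L_2\in\mathbb{R}^N$ are estimator gains. Define $$A_{aug}=\begin{bmatrix}A&0_{n\times N}\\ B_NC&A_N\end{bmatrix},\ B_{aug}=\begin{bmatrix}B\\ 0_{N\times1}\end{bmatrix},\ C_{aug}=\begin{bmatrix}D_NC&C_N\end{bmatrix},\ K_{aug}=\begin{bmatrix}K&0_{1\times N}\end{bmatrix},\ L_{aug}=\begin{bmatrix}L_1\\ L_2\end{bmatrix}.$$ $\lambda$ is an uncontrollable eigenvalue of a pair $(F,G)$,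 $F$ being $p\times p$, if $\operatorname{rank}[\lambda I-F\ \ G]<p$. ''$A-BK$ has no eigenvalues uncontrollable from $L_1$'' means $(A-BK,L_1)$ has no uncontrollable eigenvalues. A transmission zero of a scalar rational transfer function is a zero of that function in lowest terms. *)

(* Defs.v *)
From HB Require Import structures.
From mathcomp Require Import all_boot all_order all_algebra.
From mathcomp Require Import complex reals.
Set Implicit Arguments.
Unset Strict Implicit.
Unset Printing Implicit Defensive.

Import Order.TTheory GRing.Theory Num.Theory.
Local Open Scope ring_scope.
Local Open Scope complex_scope.

Section Systems.
Variable R : rcfType.

Definition ratfun := {fraction {poly R}}.

Definition ratpoly (p : {poly R}) : ratfun := FracField.tofrac p.

Definition ratmx m n (M : 'M[R]_(m, n)) : 'M[ratfun]_(m, n) :=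
  map_mx (fun a => ratpoly a%:P) M.

Definition cmx m n (M : 'M[R]_(m, n)) : 'M[R[i]]_(m, n) :=
  map_mx (real_complex R) M.

(* C (sI - A)^-1 B + D, computed in the field R(s) of real rational functions,
   over which sI - A is always invertible. *)
Definition transfer n (A : 'M[R]_n) (B : 'cV[R]_n) (C : 'rV[R]_n)
    (D : 'M[R]_1) : ratfun :=
  (ratmx C *m invmx ((ratpoly 'X)%:M - ratmx A) *m ratmx B + ratmx D) 0 0.

(* The condition f != 0 excludes the zero function, whose numerator 0 would
   otherwise make every complex number a zero. *)
Definition transmission_zero (f : ratfun) (z : R[i]) : Prop :=
  f != 0 /\
  exists p q : {poly R},
    [/\ q != 0, coprimep p q, f = ratpoly p / ratpoly q
      & root (map_poly (real_complex R) p) z].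

Definition minimal_realization n (A : 'M[R]_n) (B : 'cV[R]_n) (C : 'rV[R]_n)
    (D : 'M[R]_1) (f : ratfun) : Prop :=
  f = transfer A B C D /\
  forall m (A' : 'M[R]_m) (B' : 'cV[R]_m) (C' : 'rV[R]_m) (D' : 'M[R]_1),
    f = transfer A' B' C' D' -> (n <= m)%N.

(* Columns B, A B, ..., A^(n-1) B. *)
Definition controllable n (A : 'M[R]_n) (B : 'cV[R]_n) : Prop :=
  \rank (\matrix_(i < n, j < n) ((A ^+ j) *m B) i 0) = n.

(* Rows C, C A, ..., C A^(n-1). *)
Definition observable n (A : 'M[R]_n) (C : 'rV[R]_n) : Prop :=
  \rank (\matrix_(i < n, j < n) (C *m (A ^+ i)) 0 j) = n.

Definition ceigenvalue n (A : 'M[R]_n) (l : R[i]) : Prop :=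
  eigenvalue (cmx A) l.

Definition disjoint_spectra m n (A : 'M[R]_m) (A' : 'M[R]_n) : Prop :=
  forall l : R[i], ~ (ceigenvalue A l /\ ceigenvalue A' l).

Definition uncontrollable_eigenvalue p (F : 'M[R]_p) (G : 'cV[R]_p)
    (l : R[i]) : Prop :=
  (\rank (row_mx (l%:M - cmx F) (cmx G)) < p)%N.

Definition pade_den (tau : R) (N : nat) : {poly R} :=
  \poly_(k < N.+1)
    ((((2 * N - k)`! * N`!)%:R / ((2 * N)`! * k`! * (N - k)`!)%:R) * tau ^+ k).

Definition pade (tau : R) (N : nat) : ratfun :=
  ratpoly (pade_den tau N \Po (- 'X)) / ratpoly (pade_den tau N).

Section Augmented.
Variables (n N : nat) (A : 'M[R]_n) (B : 'cV[R]_n) (C : 'rV[R]_n).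
Variables (AN : 'M[R]_N) (BN : 'cV[R]_N) (CN : 'rV[R]_N) (DN : 'M[R]_1).
Variables (K : 'rV[R]_n) (L1 : 'cV[R]_n) (L2 : 'cV[R]_N).

Definition Aaug : 'M[R]_(n + N) := block_mx A 0 (BN *m C) AN.
Definition Baug : 'cV[R]_(n + N) := col_mx B 0.
Definition Caug : 'rV[R]_(n + N) := row_mx (DN *m C) CN.
Definition Kaug : 'rV[R]_(n + N) := row_mx K 0.
Definition Laug : 'cV[R]_(n + N) := col_mx L1 L2.
Definition Aobs : 'M[R]_(n + N) := Aaug - Baug *m Kaug - Laug *m Caug.
Definition Cobs : ratfun := transfer Aobs Laug Kaug 0.
End Augmented.

End Systems.

(* Main.v *)
Require Import Defs.
From HB Require Import structures.
From mathcomp Require Import all_boot all_order all_algebra.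
From mathcomp Require Import complex reals.
From mathcomp Require Import ring zify.
Set Implicit Arguments.
Unset Strict Implicit.
Unset Printing Implicit Defensive.
Import Order.TTheory GRing.Theory Num.Theory.
Local Open Scope ring_scope.
Local Open Scope complex_scope.

(** Write Q for the Pade denominator, so that P_N(s) = Q(-s) / Q(s), and let
    l = - z_i be the mirror image of a zero of P_N, that is, a root of Q.

    Q is, up to scaling of its argument and value, a reverse Bessel polynomial.
    The three-term recurrence of these polynomials makes the ratio of two
    consecutive ones a continued fraction with terms of nonnegative real part,
    whence Q has no root in the closed right half plane ([pade_den_hurwitz]).
    This gives Re l < 0 and the coprimality of Q(-s) and Q(s). Since Q has
    degree N, the size of A_N, coprimality forces the characteristic
    polynomial of A_N to be a multiple of Q by a constant
    ([coprime_transfer_char_poly]), so l is an eigenvalue of A_N, and (A_N, C_N)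
    has no unobservable mode ([coprime_transfer_observable]).

    Put F = A_aug - B_aug K_aug, which is block triangular with diagonal blocks
    A - B K and A_N, so that A_obs = F - L_aug C_aug. A left eigenvector w of
    A_N for l extends to a left eigenvector p of F, and condition (i) says that
    p L_aug is nonzero. If (l - A_obs) v = t L_aug, multiplication by p gives
    C_aug v = t, hence (l - F) v = 0, and the first block of v vanishes because
    l is not an eigenvalue of A - B K. For t = 0, observability of (A_N, C_N)
    yields v = 0, so l is not an eigenvalue of A_obs; for t = 1 we obtain
    K_aug (l - A_obs)^-1 L_aug = 0 ([block_injection]). Thus l is a root of
    the numerator of the compensator over the characteristic polynomial of
    A_obs, and not of that denominator: no cancellation can remove it.

    It remains to see that the compensator is not the zero function
    ([Cobs_neq0]). If it were, K (s - A + B K)^-1 L_1 would vanish. As neither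
    state feedback nor output injection affects the vanishing of a scalar
    transfer function, K (s - A + L_1 D_N C)^-1 L_1 would vanish too,
    which condition (ii) excludes at any eigenvalue of A_aug - L_aug C_aug. *)

(** * Rank-one perturbations of a matrix *)

(** Two block triangular factorizations of the same bordered matrix have
    these two determinants. *)
Lemma det_add1_rank1 (R : comUnitRingType) n (u : 'cV[R]_n) (c : 'rV[R]_n) :
  \det (1%:M + u *m c) = 1 + (c *m u) 0 0.
Proof.
have e1 : block_mx 1%:M (- u) c 1%:M
    = block_mx 1%:M 0 c 1%:M *m block_mx 1%:M (- u) 0 (1%:M + c *m u).
  rewrite mulmx_block !(mul1mx, mulmx1, mul0mx, mulmx0, addr0) mulmxN.
  by rewrite [_ + c *m u]addrC addrA addNr add0r.
have e2 : block_mx 1%:M (- u) c 1%:M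
    = block_mx (1%:M + u *m c) (- u) 0 1%:M *m block_mx 1%:M 0 c 1%:M.
  rewrite mulmx_block !(mulmx1, mulmx0, mul1mx, mul0mx, add0r) mulNmx.
  by rewrite addrK.
have := congr1 determinant e1; rewrite {1}e2 !det_mulmx !det_ublock !det_lblock.
rewrite !det1 !mulr1 !mul1r => ->.
by rewrite det_mx11 !mxE eqxx.
Qed.

Lemma det_add_rank1 (R : comUnitRingType) n (X : 'M[R]_n) (b : 'cV[R]_n)
    (c : 'rV[R]_n) : X \in unitmx ->
  \det (X + b *m c) = \det X * (1 + (c *m invmx X *m b) 0 0).
Proof.
move=> uX; rewrite -mulmxA -det_add1_rank1 -det_mulmx mulmxDr mulmx1 !mulmxA.
by rewrite mulmxV // mul1mx.
Qed.

(** State feedback moves the poles of k (s - A)^-1 v but only divides it by a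
    scalar: k (X + b k)^-1 v is k X^-1 v divided by 1 + k X^-1 b. *)
Lemma resolvent_feedback_eq0 (R : comUnitRingType) n (X : 'M[R]_n)
    (b v : 'cV[R]_n) (k : 'rV[R]_n) :
  X \in unitmx -> X + b *m k \in unitmx ->
  k *m invmx (X + b *m k) *m v = 0 -> k *m invmx X *m v = 0.
Proof.
move=> uX uY h0.
have -> : k *m invmx X = k *m invmx (X + b *m k)
    + k *m invmx X *m b *m (k *m invmx (X + b *m k)).
  rewrite [in RHS]mulmxA -mulmxDl.
  have -> : k + k *m invmx X *m b *m k = k *m invmx X *m (X + b *m k).
    by rewrite mulmxDr mulmxKV // !mulmxA.
  by rewrite -[RHS]mulmxA mulmxV // mulmx1.
by rewrite mulmxDl h0 add0r -[LHS]mulmxA h0 mulmx0.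
Qed.

(** The transpose of [resolvent_feedback_eq0]: output injection. *)
Lemma resolvent_injection_eq0 (R : comUnitRingType) n (X : 'M[R]_n)
    (b : 'cV[R]_n) (c k : 'rV[R]_n) :
  X \in unitmx -> X + b *m c \in unitmx ->
  k *m invmx (X + b *m c) *m b = 0 -> k *m invmx X *m b = 0.
Proof.
move=> uX uY h0; apply: trmx_inj; rewrite !trmx_mul trmx_inv mulmxA trmx0.
apply: (@resolvent_feedback_eq0 _ _ _ c^T); rewrite ?unitmx_tr //.
  by rewrite -trmx_mul -linearD unitmx_tr.
rewrite -trmx_mul -linearD -trmx_inv -!trmx_mul.
by rewrite mulmxA h0 trmx0.
Qed.

(** * Reverse Bessel polynomials and Pade denominators *)

Lemma Re_add_inv_gt0 (R : rcfType) (x y : R[i]) :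
  0 <= complex.Re x -> 0 < complex.Re y -> 0 < complex.Re (x + y^-1).
Proof.
case: x => a b; case: y => c d /= a0 c0.
apply: ltr_wpDl => //; rewrite divr_gt0 //.
by rewrite ltr_wpDr ?exprn_gt0 // sqr_ge0.
Qed.

Lemma Re_inv_ge0 (R : rcfType) (y : R[i]) :
  0 <= complex.Re y -> 0 <= complex.Re y^-1.
Proof.
case: y => c d /= c0; by rewrite divr_ge0 // addr_ge0 // sqr_ge0.
Qed.

Section Bessel.
Variable R : rcfType.

(** The reverse Bessel polynomial of degree m at half the argument, times a
    power of 2; this scaling makes it monic. *)
Definition bessel (m : nat) : {poly R} :=
  \poly_(k < m.+1) ((2 * m - k)`!%:R / (k`! * (m - k)`!)%:R).

(** With n = m + 2, the coefficients of x^k agree because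
    (2n - k)(2n - k - 1) = 2 (2n - 1)(n - k) + k (k - 1). *)
Lemma bessel_rec m :
  bessel m.+2 = (2 * (2 * m + 3))%N%:R *: bessel m.+1 + 'X^2 * bessel m.
Proof.
have nz k : k`!%:R != 0 :> R by rewrite pnatr_eq0 -lt0n fact_gt0.
have nS k (r : R) : r = k%:R -> 1 + r != 0.
  by move=> ->; rewrite addrC natr1 pnatr_eq0.
have nSS k (r : R) : r = k%:R -> 2 + r != 0.
  by move=> ->; rewrite -natrD pnatr_eq0.
apply/polyP => k; rewrite coefD coefZ coefXnM !coef_poly.
case: (ltnP k m.+3) => [lek|gtk]; last first.
  rewrite !ifF ?mulr0 ?addr0 //; apply/negbTE; lia.
(* For k = m + 2 the first term on the right vanishes, for k = 0 and k = 1 the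
   second one does; the truncated subtractions do not see this. *)
have [->|neqk] := eqVneq k m.+2.
  rewrite ltnn mulr0 add0r.
  have -> : (m.+2 - 2 = m)%N by lia.
  rewrite ltnSn /=.
  have -> : (2 * m.+2 - m.+2 = m.+2)%N by lia.
  have -> : (2 * m - m = m)%N by lia.
  rewrite !subnn !muln1 !divff //.
have lekm : (k <= m.+1)%N by lia.
rewrite ltnS lekm.
case: k lek neqk lekm => [|[|k]] _ _ lekm /=.
- rewrite !subn0 addr0 !mul1n.
  have -> : (2 * m.+2 = (2 * m.+1).+2)%N by lia.
  rewrite [in LHS]factS [in LHS]factS [in LHS](factS m.+1).
  have := nz m.+1; have := nz (2 * m.+1)%N.
  move: (m.+1`!) ((2 * m.+1)`!) => a b nb na.
  rewrite !natrM; field; rewrite na /=; exact: (nSS m).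
- rewrite addr0 !mul1n !subn1.
  have -> : ((2 * m.+2).-1 = (2 * m.+1).-1.+2)%N by lia.
  rewrite [in LHS]factS [in LHS]factS [in LHS](factS m) /=.
  have := nz m; have := nz (2 * m.+1).-1%N.
  have -> : ((2 * m.+1).-1.+2 = 2 * m + 3)%N by lia.
  have -> : ((2 * m.+1).-1.+1 = 2 * m + 2)%N by lia.
  move: (m`!) ((2 * m.+1).-1`!) => a b nb na.
  rewrite !natrM; field; rewrite na /=; exact: (nS m).
- have [e ->] : exists e, m = (k + e).+1 by exists (m - k.+1)%N; lia.
  rewrite !ifT; try lia.
  have -> : (2 * (k + e).+3 - k.+2 = (k + 2 * e + 2).+2)%N by lia.
  have -> : (2 * (k + e).+2 - k.+2 = k + 2 * e + 2)%N by lia.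
  have -> : (2 * (k + e).+1 - (k.+2 - 2) = k + 2 * e + 2)%N by lia.
  have -> : ((k + e).+3 - k.+2 = e.+1)%N by lia.
  have -> : ((k + e).+2 - k.+2 = e)%N by lia.
  have -> : ((k + e).+1 - (k.+2 - 2) = e.+1)%N by lia.
  have -> : (k.+2 - 2 = k)%N by lia.
  rewrite (factS (k + 2 * e + 2).+1) (factS (k + 2 * e + 2)).
  rewrite !(factS k.+1) !(factS k) !(factS e).
  have := nz (k + 2 * e + 2)%N; have := nz k; have := nz e.
  move: (e`!) (k`!) ((k + 2 * e + 2)`!) => a b c na nb nc.
  rewrite !natrM; field.
  by rewrite na nb /= (nS e) // (nS k) // (nSS k).
Qed.

Lemma pade_den_bessel (tau : R) N (s : R[i]) :
  (map_poly (real_complex R) (pade_den tau N)).[s] =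
  ((N`!%:R / (2 * N)`!%:R)%:C *
   (map_poly (real_complex R) (bessel N)).[tau%:C * s]).
Proof.
have szl : (size (map_poly (real_complex R) (pade_den tau N)) <= N.+1)%N.
  by rewrite size_map_poly size_poly.
have szr : (size (map_poly (real_complex R) (bessel N)) <= N.+1)%N.
  by rewrite size_map_poly size_poly.
rewrite (horner_coef_wide _ szl) (horner_coef_wide _ szr) mulr_sumr.
apply: eq_bigr => k _; rewrite !coef_map !coef_poly ltn_ord exprMn -rmorphXn /=.
rewrite mulrCA !mulrA -!rmorphM /=; congr (_%:C * _).
have nz j : j`!%:R != 0 :> R by rewrite pnatr_eq0 -lt0n fact_gt0.
have := nz (2 * N)%N; have := nz k; have := nz (N - k)%N.
move: ((2 * N)`!) (N`!) ((N - k)`!) (k`!) ((2 * N - k)`!) => a b c d e nc nd na.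
by rewrite !natrM; field; rewrite na nc nd.
Qed.

Lemma size_pade_den (tau : R) N : tau != 0 -> size (pade_den tau N) = N.+1.
Proof.
move=> t0; apply: size_poly_eq; rewrite mulf_neq0 ?expf_neq0 //.
rewrite mulf_neq0 ?invr_eq0 // pnatr_eq0 -lt0n ?muln_gt0 ?fact_gt0 //.
Qed.

Lemma horner_bessel_rec m (x : R[i]) :
  let q k := (map_poly (real_complex R) (bessel k)).[x] in
  q m.+2 = (2 * (2 * m + 3))%N%:R * q m.+1 + x ^+ 2 * q m.
Proof.
rewrite /= bessel_rec rmorphD /= map_polyZ rmorphM /= map_polyXn.
by rewrite hornerD hornerZ hornerM hornerXn rmorph_nat.
Qed.

(** With q_m the value at x, the recurrence reads
    q_(m+2) / (x q_(m+1)) = c / x + (q_(m+1) / (x q_m))^-1 with c > 0, and having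
    a positive real part is preserved by such a step when Re x >= 0, x <> 0. *)
Lemma bessel_hurwitz m (x : R[i]) : 0 <= complex.Re x ->
  (map_poly (real_complex R) (bessel m)).[x] != 0.
Proof.
set q := fun k => (map_poly (real_complex R) (bessel k)).[x].
rewrite -/(q m) => x0.
have [xz|xn0] := eqVneq x 0.
  rewrite /q xz horner_coef0 coef_map coef_poly /= fmorph_eq0.
  by rewrite mulf_neq0 ?invr_eq0 // pnatr_eq0 -lt0n ?muln_gt0 ?fact_gt0.
have q0 : q 0%N = 1.
  rewrite /q (_ : bessel 0 = 1) ?rmorph1 ?hornerC //.
  by apply/polyP=> [[|k]]; rewrite coef_poly coef1 //= divr1.
have q1 : q 1%N = 2 + x.
  rewrite /q (_ : bessel 1 = 2%:P + 'X).
    by rewrite rmorphD /= map_polyC map_polyX hornerD hornerC hornerX /= rmorph_nat.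
  apply/polyP=> [[|[|k]]]; rewrite coef_poly coefD coefC coefX //= ?addr0 ?add0r.
  - by rewrite divr1.
  - by rewrite divr1.
  - by [].
have Renx (c : nat) : 0 <= complex.Re (c%:R / x).
  by rewrite mulr_natl raddfMn /= mulrn_wge0 // Re_inv_ge0.
suff: q m != 0 /\ 0 < complex.Re (q m.+1 / (x * q m)) by case.
elim: m => [|m [qm pos]].
  rewrite q0 q1 oner_neq0 mulr1 mulrDl divff // -[X in _ + X]invr1.
  by split=> //; apply: Re_add_inv_gt0; rewrite ?(Renx 2) //= ltr01.
have qm1 : q m.+1 != 0.
  by apply: contraTneq pos => ->; rewrite mul0r ltxx.
split=> //; rewrite {1}/q horner_bessel_rec -!/(q _).
rewrite (_ : _ / _ = (2 * (2 * m + 3))%N%:R / x + (q m.+1 / (x * q m))^-1).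
  exact: Re_add_inv_gt0.
by field; rewrite xn0 qm1 qm.
Qed.
End Bessel.

Section Pade.
Variables (R : rcfType) (tau : R) (N : nat).
Hypothesis tau0 : 0 < tau.

Lemma pade_den_hurwitz (s : R[i]) : 0 <= complex.Re s ->
  ~~ root (map_poly (real_complex R) (pade_den tau N)) s.
Proof.
move=> s0; rewrite rootE pade_den_bessel mulf_neq0 //.
  by rewrite fmorph_eq0 mulf_neq0 ?invr_eq0 // pnatr_eq0 -lt0n fact_gt0.
apply: bessel_hurwitz; case: s s0 => a b /= a0.
by rewrite mul0r subr0 mulr_ge0 // ltW.
Qed.

Lemma root_pade_num (s : R[i]) :
  root (map_poly (real_complex R) (pade_den tau N \Po - 'X)) s =
  root (map_poly (real_complex R) (pade_den tau N)) (- s).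
Proof.
by rewrite map_comp_poly rmorphN /= map_polyX !rootE horner_comp hornerN hornerX.
Qed.

Lemma coprime_pade : coprimep (pade_den tau N \Po - 'X) (pade_den tau N).
Proof.
rewrite -(coprimep_map (real_complex R)); apply/Pdiv.ClosedField.coprimepP => s.
rewrite root_pade_num -[_ == _]/(root _ _) => ns.
apply: pade_den_hurwitz; rewrite leNgt; apply/negP => s_lt0.
have sN : 0 <= complex.Re (- s) by rewrite raddfN oppr_ge0 ltW.
by have := pade_den_hurwitz sN; rewrite ns.
Qed.

Lemma pade_mul_den :
  pade tau N * ratpoly (pade_den tau N) = ratpoly (pade_den tau N \Po - 'X).
Proof.
by rewrite /pade divfK // tofrac_eq0 -size_poly_eq0 size_pade_den // gt_eqF.
Qed.
End Pade.

(** * Transfer functions as quotients of characteristic polynomials *)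

Lemma det0_rker (F : fieldType) n (M : 'M[F]_n) :
  reflect (exists2 v : 'cV_n, v != 0 & M *m v = 0) (\det M == 0).
Proof.
rewrite -det_tr; apply: (iffP det0P) => -[v v0 vM]; exists v^T;
  rewrite ?trmx_eq0 //; apply: trmx_inj; rewrite trmx_mul ?trmxK trmx0 //.
Qed.

Lemma horner_char_poly (F : fieldType) n (A : 'M[F]_n) x :
  (char_poly A).[x] = \det (x%:M - A).
Proof.
rewrite -horner_evalE -det_map_mx; congr (\det _).
rewrite /char_poly_mx map_mxB map_scalar_mx /= /horner_eval hornerX; congr (_ - _).
by apply/matrixP=> i j; rewrite !mxE /= /horner_eval hornerC.
Qed.

Section Transfer.
Variable R : rcfType.
Implicit Types p q : {poly R}.

Lemma ratpolyM (p q : {poly R}) : ratpoly (p * q) = ratpoly p * ratpoly q.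
Proof. exact: rmorphM. Qed.

Lemma ratmxE m n (M : 'M[R]_(m, n)) :
  ratmx M = map_mx (@FracField.tofrac {poly R} \o polyC) M.
Proof. by []. Qed.

Lemma ratmx_resolvent n (A : 'M[R]_n) :
  (ratpoly 'X)%:M - ratmx A = map_mx (@FracField.tofrac {poly R}) (char_poly_mx A).
Proof.
by rewrite /char_poly_mx map_mxB map_scalar_mx -map_mx_comp.
Qed.

Lemma det_ratmx_resolvent n (A : 'M[R]_n) :
  \det ((ratpoly 'X)%:M - ratmx A) = ratpoly (char_poly A).
Proof. by rewrite ratmx_resolvent det_map_mx. Qed.

Lemma ratmx_resolvent_unit n (A : 'M[R]_n) :
  (ratpoly 'X)%:M - ratmx A \in unitmx.
Proof.
rewrite unitmxE det_ratmx_resolvent unitfE /ratpoly tofrac_eq0.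
exact/monic_neq0/char_poly_monic.
Qed.

(** Numerator over char_poly A. For D = 0 it is C adj(s - A) B, written through
    the rank-one determinant formula so that it can be evaluated at eigenvalues
    of A, where the resolvent does not exist. *)
Definition transfer_num n (A : 'M[R]_n) (B : 'cV[R]_n) (C : 'rV[R]_n)
    (D : 'M[R]_1) : {poly R} :=
  char_poly (A - B *m C) - char_poly A + D 0 0 *: char_poly A.

Lemma transferE n (A : 'M[R]_n) (B : 'cV[R]_n) (C : 'rV[R]_n) (D : 'M[R]_1) :
  transfer A B C D * ratpoly (char_poly A) =
  ratpoly (transfer_num A B C D).
Proof.
rewrite /transfer /transfer_num -mul_polyC mxE mulrDl.
rewrite (ratmxE D) [map_mx _ D _ _]mxE /=.
rewrite /ratpoly tofracD tofracB tofracM -/(ratpoly _); congr (_ + _).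
rewrite -![tofrac _]/(ratpoly _) -!det_ratmx_resolvent.
have -> : ratmx (A - B *m C) = ratmx A - ratmx B *m ratmx C.
  by rewrite !ratmxE map_mxB map_mxM.
rewrite opprB addrA addrAC det_add_rank1 ?ratmx_resolvent_unit //.
by rewrite mulrDr mulr1 addrAC subrr add0r mulrC.
Qed.

Lemma horner_cmx_char_poly n (A : 'M[R]_n) l :
  (map_poly (real_complex R) (char_poly A)).[l] = \det (l%:M - cmx A).
Proof. by rewrite map_char_poly horner_char_poly. Qed.

Lemma ceigenvalueE n (A : 'M[R]_n) l :
  ceigenvalue A l <-> root (map_poly (real_complex R) (char_poly A)) l.
Proof. by rewrite /ceigenvalue eigenvalue_root_char map_char_poly. Qed.

Lemma not_ceigenvalue_unit n (A : 'M[R]_n) l :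
  ~ ceigenvalue A l -> l%:M - cmx A \in unitmx.
Proof.
move=> Al; rewrite unitmxE unitfE; apply/negP => A0; apply: Al.
by apply/ceigenvalueE; rewrite rootE horner_cmx_char_poly.
Qed.

Lemma horner_transfer_num n (A : 'M[R]_n) B C D l :
  (map_poly (real_complex R) (transfer_num A B C D)).[l] =
  \det (l%:M - cmx A + cmx B *m cmx C) - \det (l%:M - cmx A)
  + (D 0 0)%:C * \det (l%:M - cmx A).
Proof.
rewrite /transfer_num rmorphD rmorphB /= map_polyZ hornerD hornerZ /=.
rewrite hornerD hornerN !horner_cmx_char_poly; congr (\det _ - _ + _).
by rewrite /cmx map_mxB map_mxM opprB addrA addrAC.
Qed.

Lemma horner_transfer_num_unit n (A : 'M[R]_n) B C l :
  l%:M - cmx A \in unitmx ->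
  (map_poly (real_complex R) (transfer_num A B C 0)).[l] =
  \det (l%:M - cmx A) * (cmx C *m invmx (l%:M - cmx A) *m cmx B) 0 0.
Proof.
move=> uA; rewrite horner_transfer_num det_add_rank1 //.
rewrite [_%:C](_ : _ = 0) ?mul0r ?addr0; last by rewrite mxE.
by rewrite mulrDr mulr1 addrAC subrr add0r.
Qed.

Lemma transfer_eq0_at n (A : 'M[R]_n) B C l : transfer A B C 0 = 0 ->
  l%:M - cmx A \in unitmx -> cmx C *m invmx (l%:M - cmx A) *m cmx B = 0.
Proof.
move=> f0 uA; rewrite [LHS]mx11_scalar.
have := horner_transfer_num_unit B C uA.
have -> : transfer_num A B C 0 = 0.
  by apply/eqP; rewrite -tofrac_eq0 -/(ratpoly _) -transferE f0 mul0r.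
rewrite rmorph0 horner0 => /esym/eqP; rewrite mulf_eq0.
move: uA; rewrite unitmxE unitfE => /negPf -> /eqP ->.
exact: raddf0.
Qed.

(** A zero in lowest terms is a root of the numerator of any fraction. *)
Lemma transmission_zero_root (f : ratfun R) p q z :
  q != 0 -> f * ratpoly q = ratpoly p -> transmission_zero f z ->
  root (map_poly (real_complex R) p) z.
Proof.
move=> q0 fq [_ [p' [q' [q'0 cop fE pz]]]].
have e : p' * q = p * q'.
  apply/eqP; rewrite -tofrac_eq tofracM [X in _ == X]tofracM.
  by rewrite -!/(ratpoly _) -fq fE mulrAC divfK // tofrac_eq0.
have := congr1 (fun r => root (map_poly (real_complex R) r) z) e.
rewrite /= !rmorphM /= !rootM pz /= => /esym/orP[] // q'z.
have := coprimep_root _ pz; rewrite -(coprimep_map (real_complex R)) in cop.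
by move=> /(_ _ cop); rewrite -[_ == _]/(root _ _) q'z.
Qed.

(** A root of the numerator that the denominator does not share survives the
    division of both by their greatest common divisor. *)
Lemma root_transmission_zero (f : ratfun R) p q z :
  f != 0 -> f * ratpoly q = ratpoly p ->
  root (map_poly (real_complex R) p) z ->
  ~~ root (map_poly (real_complex R) q) z ->
  transmission_zero f z.
Proof.
move=> f0 fq pz qz; split=> //.
have q0 : q != 0 by apply: contraNneq qz => ->; rewrite rmorph0 root0.
pose g := gcdp p q.
have g0 : g != 0 by rewrite gcdp_eq0 negb_and q0 orbT.
have pE : p %/ g * g = p by rewrite divpK // dvdp_gcdl.
have qE : q %/ g * g = q by rewrite divpK // dvdp_gcdr.
have q'0 : q %/ g != 0 by apply: contraNneq q0 => e; rewrite -qE e mul0r.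
exists (p %/ g), (q %/ g); split=> //.
- by rewrite coprimep_div_gcd // q0 orbT.
- apply: (canRL (mulfK _)); first by rewrite tofrac_eq0.
  have : f * ratpoly (q %/ g) * ratpoly g = ratpoly (p %/ g) * ratpoly g.
    by rewrite -mulrA -!ratpolyM qE pE.
  by move/mulIf; apply; rewrite tofrac_eq0.
- move: pz qz; rewrite -{1}pE -{1}qE !rmorphM /= !rootM negb_or.
  by move=> /orP[] // -> /andP[].
Qed.

(** A realization whose size is the degree of the reduced denominator. *)
Section Coprime.
Variables (n : nat) (A : 'M[R]_n) (B : 'cV[R]_n) (C : 'rV[R]_n) (D : 'M[R]_1).
Variables p q : {poly R}.
Hypotheses (cop : coprimep p q) (szq : size q = n.+1).
Hypothesis fq : transfer A B C D * ratpoly q = ratpoly p.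

Lemma coprime_transfer_cross : p * char_poly A = transfer_num A B C D * q.
Proof.
apply/eqP; rewrite -tofrac_eq tofracM [X in _ == X]tofracM -!/(ratpoly _).
by rewrite -fq -transferE mulrAC.
Qed.

(** Coprimality makes q divide the characteristic polynomial, and both have
    degree n. *)
Lemma coprime_transfer_char_poly : q %= char_poly A.
Proof.
rewrite -dvdp_size_eqp ?szq ?size_char_poly //.
rewrite -(@Gauss_dvdpr _ _ p); last by rewrite coprimep_sym.
by rewrite coprime_transfer_cross dvdp_mull.
Qed.

(** An unobservable mode l would be a common root of char_poly A and
    char_poly (A - B C), hence of the numerator and the denominator, which are
    proportional to p and q. *)
Lemma coprime_transfer_observable l (y : 'cV[R[i]]_n) :
  (l%:M - cmx A) *m y = 0 -> cmx C *m y = 0 -> y = 0.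
Proof.
move=> Ay Cy; apply/eqP/negP => /negP y0.
have dA : \det (l%:M - cmx A) = 0 by apply/eqP/det0_rker; exists y.
have ql : root (map_poly (real_complex R) q) l.
  move: coprime_transfer_char_poly; rewrite -(eqp_map (real_complex R)).
  by move=> /eqp_root ->; rewrite rootE horner_cmx_char_poly dA.
have nl : root (map_poly (real_complex R) (transfer_num A B C D)) l.
  rewrite rootE horner_transfer_num dA mulr0 addr0 subr0.
  by apply/det0_rker; exists y; rewrite // mulmxDl Ay -mulmxA Cy mulmx0 addr0.
have /eqpP[[a b] /= /andP[a0 b0] e] := coprime_transfer_char_poly.
have q0 : q != 0 by rewrite -size_poly_eq0 szq.
have pE : a *: p = b *: transfer_num A B C D.
  apply: (mulIf q0); rewrite -!scalerAl -coprime_transfer_cross.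
  by rewrite !scalerAr e.
have pl : root (map_poly (real_complex R) p) l.
  have := nl; rewrite -(@rootZ _ _ b%:C) ?fmorph_eq0 //.
  by rewrite -map_polyZ -pE map_polyZ rootZ ?fmorph_eq0.
have cop' := cop; rewrite -(coprimep_map (real_complex R)) in cop'.
by have := coprimep_root cop' pl; rewrite -[_ == _]/(root _ _) ql.
Qed.
End Coprime.
End Transfer.

(** * The observer-based compensator *)

Lemma mul_mx11_cancel (F : fieldType) (a b : 'M[F]_1) (t : F) :
  a != 0 -> a *m b = t *: a -> b = t%:M.
Proof.
rewrite (mx11_scalar a); move: (a 0 0) => {}a a0.
rewrite mul_scalar_mx scale_scalar_mx mulrC -scale_scalar_mx; apply: scalerI.
by apply: contraNneq a0 => ->; rewrite raddf0.
Qed.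

(** With X = l - A + B K, Y = l - A_N and G = B_N C, the matrix M is
    l - A_obs. The row p = (w G X^-1, w) annihilates the block triangular part
    from the left, which turns M v = t L into c v = t and decouples the blocks. *)
Lemma block_injection (F : fieldType) n N (X : 'M[F]_n) (Y : 'M[F]_N)
    (G : 'M[F]_(N, n)) (L1 : 'cV[F]_n) (L2 : 'cV[F]_N)
    (c1 : 'rV[F]_n) (c2 : 'rV[F]_N) (w : 'rV[F]_N) :
  X \in unitmx -> w *m Y = 0 ->
  w *m G *m invmx X *m L1 + w *m L2 != 0 ->
  (forall y : 'cV_N, Y *m y = 0 -> c2 *m y = 0 -> y = 0) ->
  let M := block_mx X 0 (- G) Y + col_mx L1 L2 *m row_mx c1 c2 in
  M \in unitmx /\
  forall k : 'rV_n, row_mx k 0 *m invmx M *m col_mx L1 L2 = 0.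
Proof.
move=> uX wY0 pL0 obsY M; set L := col_mx L1 L2; set c := row_mx c1 c2.
pose p := row_mx (w *m G *m invmx X) w.
have pF : p *m block_mx X 0 (- G) Y = 0.
  rewrite mul_row_block mulmxKV // mulmxN addrN mulmx0 add0r wY0.
  exact: row_mx0.
have pL : p *m L != 0 by rewrite mul_row_col.
(* Used with t = 0 for injectivity of M and with t = 1 for v = M^-1 L. *)
have key (v : 'cV_(n + N)) t : M *m v = t *: L ->
    [/\ c *m v = t%:M, usubmx v = 0 & Y *m dsubmx v = 0].
  move=> Mv.
  have cv : c *m v = t%:M.
    apply: (mul_mx11_cancel pL); rewrite scalemxAr -Mv /M mulmxDl mulmxDr.
    by rewrite !mulmxA pF mul0mx add0r.
  have : block_mx X 0 (- G) Y *m v = 0.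
    move: Mv; rewrite /M mulmxDl -mulmxA -/L -/c cv mul_mx_scalar.
    by rewrite -[RHS]add0r => /addIr.
  rewrite -[v]vsubmxK mul_block_col mul0mx addr0 => /eqP.
  rewrite col_mx_eq0 => /andP[/eqP Xv /eqP Yv].
  have v1 : usubmx v = 0 by rewrite -(mulKmx uX (usubmx v)) Xv mulmx0.
  rewrite vsubmxK; split=> //.
  by move: Yv; rewrite v1 mulmx0 add0r.
have uM : M \in unitmx.
  rewrite unitmxE unitfE; apply/negP => /det0_rker[v v0 Mv].
  have [] := key v 0; first by rewrite scale0r.
  rewrite -[v]vsubmxK mul_row_col col_mxKu col_mxKd => cv v1 Yv.
  move: v0; rewrite -[v]vsubmxK v1 (obsY _ Yv) ?col_mx0 ?eqxx //.
  by move: cv; rewrite v1 mulmx0 add0r => ->; rewrite raddf0.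
split=> // k; rewrite -mulmxA; set v := invmx M *m L.
have [|_ v1 _] := key v 1; first by rewrite scale1r mulKVmx.
by rewrite -[v]vsubmxK mul_row_col v1 mulmx0 mul0mx addr0.
Qed.

(** Stated along any ring morphism because it is needed twice: at a complex
    number, and at the indeterminate of the field of rational functions. *)
Lemma observer_resolvent (R : rcfType) (S : comNzRingType) (f : {rmorphism R -> S})
    n N (A : 'M[R]_n) (B : 'cV[R]_n) (C : 'rV[R]_n) (AN : 'M[R]_N)
    (BN : 'cV[R]_N) (CN : 'rV[R]_N) (DN : 'M[R]_1) (K : 'rV[R]_n)
    (L1 : 'cV[R]_n) (L2 : 'cV[R]_N) (t : S) :
  t%:M - map_mx f (Aobs A B C AN BN CN DN K L1 L2) =
  block_mx (t%:M - map_mx f A + map_mx f B *m map_mx f K) 0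
           (- (map_mx f BN *m map_mx f C)) (t%:M - map_mx f AN)
  + col_mx (map_mx f L1) (map_mx f L2)
    *m row_mx (map_mx f DN *m map_mx f C) (map_mx f CN).
Proof.
rewrite /Aobs /Aaug /Baug /Kaug /Laug /Caug !map_mxB !map_mxM.
rewrite map_block_mx !map_col_mx !map_row_mx !map_mx0 !map_mxM.
rewrite opprB addrCA addrC; congr (_ + _).
rewrite mul_col_row !(mulmx0, mul0mx) opprB addrA.
rewrite scalar_mx_block opp_block_mx !add_block_mx.
by rewrite !(addr0, add0r, oppr0) addrAC.
Qed.

(** The vanishing passes from the compensator to K (s - A + B K)^-1 L_1 by
    removing the injection L_aug C_aug, then to K (s - A)^-1 L_1 by removing the
    feedback B K, and finally to K (s - A + L_1 D_N C)^-1 L_1. *)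
Lemma Cobs_neq0 (R : rcfType) n N (A : 'M[R]_n) (B : 'cV[R]_n) (C : 'rV[R]_n)
    (AN : 'M[R]_N) (BN : 'cV[R]_N) (CN : 'rV[R]_N) (DN : 'M[R]_1)
    (K : 'rV[R]_n) (L1 : 'cV[R]_n) (L2 : 'cV[R]_N) (l : R[i]) :
  ~ ceigenvalue (A - L1 *m DN *m C) l ->
  cmx K *m invmx (l%:M - cmx (A - L1 *m DN *m C)) *m cmx L1 != 0 ->
  Cobs A B C AN BN CN DN K L1 L2 != 0.
Proof.
move=> Al; apply: contra_neq => Cobs0.
apply: transfer_eq0_at; last exact: not_ceigenvalue_unit.
pose X n' (M : 'M[R]_n') := (ratpoly 'X)%:M - ratmx M.
have uX n' (M : 'M[R]_n') : X n' M \in unitmx by exact: ratmx_resolvent_unit.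
have transfer0 n' (M : 'M[R]_n') b c :
    transfer M b c 0 = (ratmx c *m invmx (X _ M) *m ratmx b) 0 0.
  by rewrite /transfer mxE (ratmxE 0) map_mx0 [X in _ + X]mxE addr0.
have eq0 (M : 'M[ratfun R]_1) : M 0 0 = 0 -> M = 0.
  by rewrite {2}[M]mx11_scalar => ->; rewrite raddf0.
rewrite transfer0.
have XF : X _ (A - B *m K) = X _ A + ratmx B *m ratmx K.
  by rewrite /X !ratmxE map_mxB map_mxM opprB addrA addrAC.
have XL : X _ A = X _ (A - L1 *m DN *m C) + ratmx L1 *m (- (ratmx DN *m ratmx C)) .
  by rewrite /X !ratmxE map_mxB !map_mxM mulmxN mulmxA opprB addrA addrAC addrK.
have {Cobs0} : ratmx K *m invmx (X _ (A - B *m K)) *m ratmx L1 = 0.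
  move: Cobs0; rewrite /Cobs transfer0 => /eq0.
  rewrite /Kaug /Laug !ratmxE map_row_mx map_col_mx map_mx0 -!ratmxE.
  have := uX _ (Aobs A B C AN BN CN DN K L1 L2).
  rewrite /X [ratmx (Aobs _ _ _ _ _ _ _ _ _ _)]ratmxE observer_resolvent -!ratmxE.
  rewrite -/(X _ A) -XF -/(X _ AN).
  set F := block_mx _ _ _ _ => uM M0.
  have uF : F \in unitmx.
    by rewrite unitmxE det_lblock unitrM -!unitmxE !uX.
  have := resolvent_injection_eq0 uF uM M0.
  (* F is block lower triangular and K_aug only sees its first block. *)
  suff -> : row_mx (ratmx K) 0 *m invmx F =
            row_mx (ratmx K *m invmx (X _ (A - B *m K))) 0.
    by rewrite mul_row_col mul0mx addr0.
  apply: (canLR (mulmxK uF)).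
  by rewrite mul_row_block mulmxKV ?uX // !(mulmx0, mul0mx) !addr0.
rewrite XF => /resolvent_feedback_eq0 K0.
have {}K0 : ratmx K *m invmx (X _ A) *m ratmx L1 = 0 by apply: K0; rewrite -?XF uX.
(* Here the injection to be removed is - D_N C. *)
rewrite XL in K0; rewrite (resolvent_injection_eq0 _ _ K0) ?mxE ?uX //.
by rewrite -XL uX.
Qed.

Theorem mainTheorem2 (R : realType) (n N : nat) (tau : R)
    (A : 'M[R]_n) (B E : 'cV[R]_n) (C : 'rV[R]_n)
    (AN : 'M[R]_N) (BN : 'cV[R]_N) (CN : 'rV[R]_N) (DN : 'M[R]_1)
    (K : 'rV[R]_n) (L1 : 'cV[R]_n) (L2 : 'cV[R]_N)
    (z : 'I_N -> R[i])
    (hn : (1 <= n)%N) (hN : (1 <= N)%N) (htau : 0 < tau)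
    (hAC : observable A C) (hAB : controllable A B) (hAE : controllable A E)
    (hPN : minimal_realization AN BN CN DN (pade tau N))
    (* z_1, ..., z_N are the zeros of P_N *)
    (hz : forall s : R[i],
      transmission_zero (pade tau N) s <-> exists i, z i = s)
    (* (i) *)
    (hi1 : disjoint_spectra AN (A - B *m K))
    (hi2 : forall l : R[i], ~ uncontrollable_eigenvalue (A - B *m K) L1 l)
    (hi3 : forall (l : R[i]) (w : 'rV[R[i]]_N),
      w != 0 -> w *m cmx AN = l *: w ->
      w *m cmx BN *m cmx C *m invmx (l%:M - cmx A + cmx B *m cmx K) *m cmx L1
        + w *m cmx L2 != 0)
    (* (ii) *)
    (hii1 : disjoint_spectra
      (Aaug A C AN BN - Laug L1 L2 *m Caug C CN DN) (A - L1 *m DN *m C))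
    (hii2 : forall l : R[i],
      ceigenvalue (Aaug A C AN BN - Laug L1 L2 *m Caug C CN DN) l ->
      cmx K *m invmx (l%:M - cmx A + cmx L1 *m cmx DN *m cmx C) *m cmx L1 != 0) :
  forall i : 'I_N,
    complex.Re (- z i) < 0 /\
    transmission_zero (Cobs A B C AN BN CN DN K L1 L2) (- z i).
Proof.
move=> i; set l := - z i.
have szq : size (pade_den tau N) = N.+1 by rewrite size_pade_den // gt_eqF.
have q0 : pade_den tau N != 0 by rewrite -size_poly_eq0 szq.
have fq := pade_mul_den N htau; have cop := coprime_pade N htau.
have ql : root (map_poly (real_complex R) (pade_den tau N)) l.
  rewrite -root_pade_num; apply: transmission_zero_root q0 fq _.
  by apply/hz; exists i.
have l_lt0 : complex.Re l < 0.
  by rewrite ltNge; apply: contraL ql; apply: pade_den_hurwitz.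
split=> //.
case: hPN => eP _; rewrite eP in fq.
have chiAN := coprime_transfer_char_poly cop szq fq.
have ANl : ceigenvalue AN l.
  apply/ceigenvalueE; move: chiAN; rewrite -(eqp_map (real_complex R)).
  by move=> /eqp_root <-.
have uBK : l%:M - cmx (A - B *m K) \in unitmx.
  by apply: not_ceigenvalue_unit => Al; exact: (hi1 l (conj ANl Al)).
have BKE t : t%:M - cmx (A - B *m K) = t%:M - cmx A + cmx B *m cmx K.
  by rewrite /cmx map_mxB map_mxM opprB addrA addrAC.
have LE t : t%:M - cmx (A - L1 *m DN *m C) =
    t%:M - cmx A + cmx L1 *m cmx DN *m cmx C.
  by rewrite /cmx map_mxB !map_mxM opprB addrA addrAC.
rewrite BKE in uBK.
have /eigenvalueP[w wAN w0] := ANl.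
have wY : w *m (l%:M - cmx AN) = 0.
  by rewrite mulmxBr mul_mx_scalar wAN subrr.
have pL : w *m (cmx BN *m cmx C) *m invmx (l%:M - cmx A + cmx B *m cmx K)
    *m cmx L1 + w *m cmx L2 != 0 by rewrite mulmxA; apply: hi3.
have [uM Cl] := block_injection (cmx DN *m cmx C) uBK wY pL
  (coprime_transfer_observable cop szq fq (l := l)).
rewrite -observer_resolvent -/(cmx _) in uM Cl.
have [m mE] : exists m, ceigenvalue
    (Aaug A C AN BN - Laug L1 L2 *m Caug C CN DN) m.
  set M := (_ - _); have /closed_rootP[m mM] :
      size (map_poly (real_complex R) (char_poly M)) != 1.
    by rewrite size_map_poly size_char_poly; case: (n) hn.
  by exists m; apply/ceigenvalueE.
apply: (root_transmission_zero _ (transferE _ _ _ _)).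
- apply: (@Cobs_neq0 _ _ _ _ _ _ _ _ _ _ _ _ _ m).
    by move=> Am; exact: (hii1 m (conj mE Am)).
  by rewrite LE; apply: hii2.
- rewrite rootE horner_transfer_num_unit //.
  rewrite /Kaug /Laug /cmx map_row_mx map_col_mx map_mx0 -!/(cmx _).
  by rewrite Cl mxE mulr0.
- by rewrite rootE horner_cmx_char_poly -unitfE -unitmxE.
Qed.
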